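(* Let $n_1,\dots,n_k$ be positive integers, $L=\operatorname{lcm}(n_1,\dots,n_k)$, $A=\prod_{j=1}^k\mathbb{Z}/n_j\mathbb{Z}$, and $w\in\mathbb{N}$ a positive integer. For each prime $p$ let $h_p:=\max\{\operatorname{ord}_p(n_j): 1\le j\le k\}$ and for $1\le i\le h_p$ let $m_{p,i}:=\#\{j\in\{1,\dots,k\}:\operatorname{ord}_p(n_j)=i\}$, so that $A\cong\prod_p\prod_{i=1}^{h_p}(\mathbb{Z}/p^i\mathbb{Z})^{m_{p,i}}$. Then $$\frac1L\sum_{l=1}^{L}\bigl(\gcd(l,n_1)\cdots\gcd(l,n_k)\bigr)^w=\prod_p\mu\Bigl(\prod_{i=1}^{h_p}(\mathbb{Z}/p^i\mathbb{Z})^{w m_{p,i}}\Bigr)$$ $$=\prod_p\left(1+\sum_{l=1}^{h_p}\Bigl(p^{w\sum_{i=l}^{h_p}m_{p,i}}-1\Bigr)p^{w\left(\sum_{i=1}^{l-1}i\,m_{p,i}+(l-1)\sum_{i=l}^{h_p}m_{p,i}\right)}\frac{1}{p^l}\right)=\prod_p\left(1+\sum_{l=1}^{h_p}\Bigl(p^{w\sum_{i=l}^{h_p}m_{p,i}}-1\Bigr)p^{w\left(\sum_{i=1}^{l-1}i\,m_{p,i}+(l-1)\sum_{i=l}^{h_p}m_{p,i}\right)-l}\right),$$ where the products run over all primes $p$ (all but finitely many factors equal $1$, namely those with $h_p=0$).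
   Context: For a finite abelian group $B$, $\mu(B):=\sum_{b\in B}\frac{1}{|b|}$, where $|b|$ is the order of $b$. $\operatorname{ord}_p(n)$ is the exponent of the prime $p$ in $n$. Empty sums are $0$. *)

(* Defs.v *)
From mathcomp Require Import all_boot all_order all_fingroup all_algebra all_solvable.
From mathcomp Require Import boolp classical_sets cardinality fsbigop.

Set Implicit Arguments.
Unset Strict Implicit.
Unset Printing Implicit Defensive.

Import GroupScope GRing.Theory Num.Theory.
Local Open Scope ring_scope.

Definition mu (gT : finGroupType) (B : {group gT}) : rat :=
  \sum_(b in B) (#[b]%g%:R)^-1.

Section Family.

Variables (k : nat) (n : 'I_k -> nat).

Definition lcm_fam : nat := \big[lcmn/1%N]_(j < k) n j.

Definition max_logn (p : nat) : nat := (\max_(j < k) logn p (n j))%N.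

Definition count_logn (p i : nat) : nat := #|[pred j : 'I_k | logn p (n j) == i]|.

(* [Zp d] is used rather than all of ['Z_d] because ['Z_1] is Z/2Z, whereas
   [Zp 1] is trivial. *)
Definition cyclic_prod :=
  setXn_group (fun j : 'I_k => Zp_group (n j)).

End Family.

(* (Z/dZ)^c *)
Definition Zp_pow (d c : nat) :=
  setXn_group (fun _ : 'I_c => Zp_group d).

(* prod_(i = 1)^h (Z/p^iZ)^(c i); the ordinal [i : 'I_h] stands for i.+1. *)
Definition ppart_group (p h : nat) (c : nat -> nat) :=
  setXn_group (fun i : 'I_h => Zp_pow (p ^ i.+1) (c i.+1)).

(* The product over all primes p of the groups [ppart_group p (h p) (c p)]
   when h vanishes at the primes outside the list s. *)
Definition primary_prod (s : seq nat) (h : nat -> nat) (c : nat -> nat -> nat) :=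
  setXn_group (fun p : seq_sub s => ppart_group (ssval p) (h (ssval p)) (c (ssval p))).

Section Factor.

Variables (w p h : nat) (m : nat -> nat).

Definition tail_count (l : nat) : nat := (\sum_(l <= i < h.+1) m i)%N.

Definition level_exp (l : nat) : nat :=
  (w * (\sum_(1 <= i < l) i * m i + l.-1 * tail_count l))%N.

Definition factor_frac : rat :=
  1 + \sum_(1 <= l < h.+1)
        (p%:R ^+ (w * tail_count l) - 1) * p%:R ^+ level_exp l * (p%:R ^+ l)^-1.

(* The exponent is an integer: it is -1 for l = 1. *)
Definition factor_exp : rat :=
  1 + \sum_(1 <= l < h.+1)
        (p%:R ^+ (w * tail_count l) - 1) * p%:R ^ ((level_exp l)%:Z - l%:Z).

End Factor.

(* Main.v *)
Require Import Defs.
From mathcomp Require Import all_boot all_order all_fingroup all_algebra all_solvable.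
From mathcomp Require Import boolp classical_sets cardinality fsbigop.

(** For a finite group [G] whose element orders divide [N], counting the pairs
    [(l, b)] with [1 <= l <= N] and [b ^+ l = 1] in two ways gives
    [N * mu G = \sum_l #|'Ldiv_l(G)|].  The number of [l]-torsion elements is
    multiplicative over direct products and equals [gcdn l d] on Z/dZ, so the
    left-hand side of the identity is [mu] of the [w]-th power of
    \prod_j Z/n_jZ, which has as many [l]-torsion elements as the product of
    its primary parts.  As [mu] is multiplicative over products of groups of
    coprime exponents, it splits into the primary factors.  On a [p]-group,
    sorting the elements by their order [p ^ l] expresses [mu] through the
    differences of the [p ^ l]- and [p ^ l.-1]-torsion counts. *)

Set Implicit Arguments.
Unset Strict Implicit.
Unset Printing Implicit Defensive.

Import GRing.Theory Num.Theory.

(** * Arithmetic of gcds and prime parts *)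

Lemma gcdn_mul_coprime l a b :
  coprime a b -> gcdn l (a * b) = (gcdn l a * gcdn l b)%N.
Proof.
move=> co_ab; apply/eqP; rewrite eqn_dvd; apply/andP; split.
  rewrite muln_gcdl !muln_gcdr !dvdn_gcd dvdn_gcdr andbT.
  by rewrite dvdn_mulr 1?dvdn_mulr 1?dvdn_mull ?dvdn_gcdl.
rewrite dvdn_gcd dvdn_mul ?dvdn_gcdr // andbT Gauss_dvd ?dvdn_gcdl //.
exact: (coprime_dvdl (dvdn_gcdr _ _) (coprime_dvdr (dvdn_gcdr _ _) co_ab)).
Qed.

Lemma sum_dvdn_multiples d N :
  (0 < d)%N -> (\sum_(1 <= l < N.+1) (d %| l) = N %/ d)%N.
Proof.
move=> d_gt0; elim: N => [|N IH]; first by rewrite big_geq ?div0n.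
by rewrite big_nat_recr //= IH divnS // addnC.
Qed.

Lemma big_seq_sub (R : Type) (idx : R) (op : Monoid.com_law idx)
    (T : choiceType) (s : seq T) (F : T -> R) : uniq s ->
  \big[op/idx]_(x : seq_sub s) F (ssval x) = \big[op/idx]_(x <- s) F x.
Proof.
move=> uniq_s; rewrite -(big_image op idx (@ssval T s)); apply: perm_big.
apply: uniq_perm => // [|x].
  by rewrite map_inj_uniq ?enum_uniq //; apply: val_inj.
apply/fintype.imageP/idP => [[y _ ->]|xs]; first exact: ssvalP.
by exists (SeqSub xs).
Qed.

Lemma prod_partn_primes L N : (0 < L)%N -> N %| L ->
  (\prod_(p <- primes L) N`_p)%N = N.
Proof.
move=> L_gt0 dvdNL; have N_gt0 := dvdn_gt0 L_gt0 dvdNL.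
have piN : \pi(L).-nat N by apply: pnat_dvd (pnat_pi L_gt0).
rewrite -[RHS](part_pnat_id piN) (widen_partn _ (dvdn_leq L_gt0 dvdNL)).
rewrite -[RHS]big_filter; under eq_bigr do rewrite p_part.
apply: perm_big; apply: uniq_perm; rewrite ?primes_uniq //.
  by rewrite filter_uniq ?iota_uniq.
move=> p; rewrite mem_filter mem_index_iota ltnS.
apply/idP/andP => [pL | [] //]; split=> //.
by move: pL; rewrite mem_primes => /and3P[_ _ /(dvdn_leq L_gt0)].
Qed.

(** The parts of [N] at distinct primes are coprime, and [gcdn l] is multiplicative over coprime
    factors. Indexing by [primes L] lets all divisors of [L] share one list of primes; a prime not
    dividing [N] contributes [gcdn l 1 = 1]. *)
Lemma prod_gcdn_partn L N l : (0 < L)%N -> N %| L ->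
  (\prod_(p <- primes L) gcdn l N`_p)%N = gcdn l N.
Proof.
move=> L_gt0 dvdNL; rewrite -[in RHS](prod_partn_primes L_gt0 dvdNL).
have: all prime (primes L) by apply/allP=> p; rewrite mem_primes => /and3P[].
elim: (primes L) (primes_uniq L) => [|p s IH] /=; first by rewrite !big_nil gcdn1.
case/andP=> p_s uniq_s /andP[p_pr s_pr]; rewrite !big_cons IH //.
rewrite gcdn_mul_coprime // big_seq coprime_sym.
apply: (big_ind (fun x => coprime x N`_p)) => [|x y cx cy|q q_s].
- exact: coprime1n.
- by rewrite coprimeMl cx.
have q_pr := allP s_pr q q_s.
rewrite !p_part coprimeXl // coprimeXr // prime_coprime // dvdn_prime2 //.
by apply: contra p_s => /eqP <-.
Qed.

(** * Torsion, orders and [mu] in direct products *)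

Section Products.

Variables (I : finType) (gT : I -> finGroupType).
Implicit Types (G : forall i, {group gT i}) (x : {dffun forall i, gT i}).

Lemma expg_dffun x l i : (x ^+ l)%g i = (x i ^+ l)%g.
Proof. by elim: l => [|l IH]; rewrite ?expg0 ?oneg_ffun // !expgS mulg_ffun IH. Qed.

Lemma order_dvdn_dffun x N :
  reflect (forall i, #[x i]%g %| N) (#[x]%g %| N).
Proof.
rewrite order_dvdn; apply: (iffP eqP) => [xN1 i | xN1].
  by rewrite order_dvdn -expg_dffun xN1 oneg_ffun.
apply/ffunP => i; rewrite expg_dffun oneg_ffun; apply/eqP.
by rewrite -order_dvdn.
Qed.

Lemma Ldiv_setXn G l :
  'Ldiv_l(setXn G)%g = setXn (fun i => 'Ldiv_l(G i)%g).
Proof.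
apply/setP => x; apply/LdivP/setXnP => [[/setXnP Gx x1] i | Gx].
  by apply/LdivP; rewrite -expg_dffun x1 oneg_ffun; split; first exact: Gx.
split; first by apply/setXnP => i; case/LdivP: (Gx i).
by apply/ffunP => i; rewrite expg_dffun oneg_ffun; case/LdivP: (Gx i).
Qed.

Lemma card_Ldiv_setXn G l :
  #|'Ldiv_l(setXn G)%g| = (\prod_i #|'Ldiv_l(G i)%g|)%N.
Proof. by rewrite Ldiv_setXn cardsXn. Qed.

Lemma order_coprime_dffun x :
    (forall i j, i != j -> coprime #[x i]%g #[x j]%g) ->
  #[x]%g = (\prod_i #[x i]%g)%N.
Proof.
move=> co_x; apply/eqP; rewrite eqn_dvd; apply/andP; split.
  by apply/order_dvdn_dffun => i; rewrite (bigD1 i) //= dvdn_mulr.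
apply/unstable.Gauss_dvd_prod => [|i _ _]; last exact: (order_dvdn_dffun _ _ _).
rewrite pairwise_map; have: uniq [seq i <- index_enum I | true].
  by rewrite filter_uniq ?index_enum_uniq.
rewrite uniq_pairwise; apply: sub_pairwise => i j; exact: co_x.
Qed.

(** This is distributivity of product over sum with a different type at each index. Each [F i] is
    extended by zero outside [G i], the pairs of an index and a value are gathered in a tagged type,
    and the choice functions are carried back to dependent functions. *)
Lemma sum_setXn_prod (R : comPzRingType) G (F : forall i, gT i -> R) :
  (\sum_(x in setXn G) \prod_i F i (x i) = \prod_i \sum_(y in G i) F i y)%R.
Proof.
pose P i : {ffun gT i -> R} := [ffun y => if y \in G i then F i y else 0%R].
under [RHS]eq_bigr => i _.
  rewrite big_mkcond; under eq_bigr => y _.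
    rewrite (_ : (if _ then _ else _) = P i y); last by rewrite ffunE.
  over.
  rewrite (big_tag (fun i => P i)).
over.
rewrite bigA_distr_big_dep -(big_fprod _ _ P).
rewrite (reindex (@fprod_of_dffun I gT)); last first.
  exact/onW_bij/fprod_of_dffun_bij.
rewrite big_mkcond; apply: eq_bigr => x _ /=.
case: ifP => [/setXnP Gx|].
  by apply: eq_bigr => i _; rewrite fprodE ffunE Gx.
move/negbT; rewrite in_setXn negb_forall => /existsP[i Gxi].
by rewrite (bigD1 i) //= fprodE ffunE (negbTE Gxi) mul0r.
Qed.

(** Coprime exponents make the order of a tuple the product of the orders of its entries, so the
    summand of [mu] is a product of functions of one coordinate each. *)
Lemma mu_setXn_coprime G (e : I -> nat) :
    (forall i y, y \in G i -> #[y]%g %| e i) ->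
    (forall i j, i != j -> coprime (e i) (e j)) ->
  mu (setXn_group G) = (\prod_i mu (G i))%R.
Proof.
move=> expG coG; rewrite /mu -(sum_setXn_prod G (fun i y => #[y]%g%:R^-1)%R).
apply: eq_bigr => x /setXnP Gx; rewrite order_coprime_dffun.
  by rewrite natr_prod prodfV.
move=> i j /coG /(coprime_dvdl (expG i _ (Gx i))).
by apply: coprime_dvdr; apply: expG; apply: Gx.
Qed.

End Products.

(** * Torsion counts and their relation to [mu] *)

Section Torsion.

Variable gT : finGroupType.
Implicit Type G : {group gT}.

(** The [l]-torsion of [<[a]>] is its subgroup of order [d]. If [a ^+ i] is killed by [l], then
    [#[a]] divides both [i * l] and [i * #[a]], hence [i * d], so [#[a] %/ d] divides [i]. *)
Lemma card_Ldiv_cycle (a : gT) l : #|'Ldiv_l(<[a]>)%g| = gcdn l #[a]%g.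
Proof.
set d := gcdn l _; have dvd_d : d %| #[a]%g by apply: dvdn_gcdr.
have d_gt0 : (0 < d)%N by rewrite gcdn_gt0 order_gt0 orbT.
suff -> : 'Ldiv_l(<[a]>)%g = <[a ^+ (#[a]%g %/ d)]>%g.
  by rewrite -orderE orderXdiv ?dvdn_div // divnA // mulKn ?order_gt0.
apply/setP => x; apply/LdivP/cycleP => [[/cycleP[i ->]]|[i ->]].
  move/eqP; rewrite -expgM -order_dvdn => ail.
  have: #[a]%g %| i * d by rewrite muln_gcdr dvdn_gcd ail dvdn_mull.
  rewrite -{1}(divnK dvd_d) dvdn_pmul2r // => /dvdnP[j ->].
  by exists j; rewrite -expgM mulnC.
split; first by rewrite !groupX ?cycle_id.
apply/eqP; rewrite -!expgM -order_dvdn.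
rewrite -{1}(divnK dvd_d) dvdn_mul // dvdn_mull //.
exact: dvdn_gcdl.
Qed.

Lemma natr_card_Ldiv G l :
  #|'Ldiv_l(G)%g|%:R%R = (\sum_(b in G) (#[b]%g %| l)%N%:R)%R :> rat.
Proof.
rewrite -sum1_card natr_sum [RHS]big_mkcond /= [LHS]big_mkcond /=.
apply: eq_bigr => b _; rewrite !inE order_dvdn.
by case: (b \in G); case: (_ == _).
Qed.

Lemma mul_mu_sum_Ldiv G N : (0 < N)%N -> (forall b, b \in G -> #[b]%g %| N) ->
  (N%:R * mu G = \sum_(1 <= l < N.+1) #|'Ldiv_l(G)%g|%:R)%R.
Proof.
move=> N_gt0 expG; under eq_bigr do rewrite natr_card_Ldiv.
rewrite exchange_big /= /mu mulr_sumr; apply: eq_bigr => b Gb.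
rewrite -natr_sum sum_dvdn_multiples ?order_gt0 //.
rewrite -[in LHS](divnK (expG b Gb)) natrM mulfK //.
by rewrite pnatr_eq0 -lt0n order_gt0.
Qed.

Lemma mu_pgroup_Ldiv G p h : prime p ->
    (forall b, b \in G -> #[b]%g %| p ^ h) ->
  (mu G = 1 + \sum_(1 <= l < h.+1)
    (#|'Ldiv_(p ^ l)(G)%g|%:R - #|'Ldiv_(p ^ l.-1)(G)%g|%:R) * (p%:R ^+ l)^-1)%R.
Proof.
move=> p_pr expG.
(* The leading 1 is rewritten as the term of level 0, so that both sides become sums over [G] and
   can be compared element by element. *)
have E1 : (#|'Ldiv_(p ^ 0)(G)%g|%:R * (p%:R ^+ 0)^-1)%R = 1%R :> rat.
  rewrite expn0 expr0 invr1 mulr1 (_ : 'Ldiv_1(G)%g = [set 1%g]) ?cards1 //.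
  apply/setP => x; rewrite finset.in_set1; apply/LdivP/eqP => [[_]|->].
    by rewrite expg1.
  by rewrite group1 expg1.
rewrite -[X in (X + _)%R]E1.
under eq_bigr do rewrite !natr_card_Ldiv -sumrB mulr_suml.
rewrite natr_card_Ldiv exchange_big /= mulr_suml -big_split /=; apply: eq_bigr => b Gb.
have /(dvdn_pfactor _ _ p_pr)[e le_eh ->] := expG b Gb.
have dvdE k : (p ^ e %| p ^ k) = (e <= k)%N by rewrite dvdn_Pexp2l ?prime_gt1.
rewrite dvdE leqn0 natrX.
(* For [b] of order [p ^ e] the difference of the indicators of [e <= l] and [e <= l.-1] is that of
   [l = e], so only one level survives; for [e = 0] it is the leading term. *)
have -> : (\sum_(1 <= l < h.+1)
    ((p ^ e %| p ^ l)%N%:R - (p ^ e %| p ^ l.-1)%N%:R) * (p%:R ^+ l)^-1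
  = \sum_(1 <= l < h.+1 | l == e) (p%:R ^+ l)^-1 :> rat)%R.
  rewrite [RHS]big_mkcond; apply: eq_big_nat => -[//|l] _ /=.
  rewrite !dvdE leq_eqVlt ltnS eq_sym; have [<-|_] := eqVneq l.+1 e.
    by rewrite ltnn subr0 mul1r.
  by rewrite subrr mul0r.
rewrite big_nat1_eq ltnS le_eh andbT.
by case: e {dvdE le_eh} => [|e] /=; rewrite ?addr0 ?mul1r ?mul0r ?add0r.
Qed.

End Torsion.

Lemma card_Ldiv_Zp d l : (0 < d)%N -> #|'Ldiv_l(Zp d)%g| = gcdn l d.
Proof.
move=> d_gt0; have -> : gcdn l d = gcdn l #|Zp d| by rewrite card_Zp.
suff [a ->] : exists a, Zp d = <[a]>%g by rewrite card_Ldiv_cycle.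
rewrite /Zp; case: ifP => _; first by exists Zp1; rewrite Zp_cycle.
by exists 1%g; rewrite cycle1.
Qed.

Lemma order_Zp_dvdn d (z : 'Z_d) : 0 < d -> z \in Zp d -> #[z]%g %| d.
Proof. by move=> d_gt0 /order_dvdG; rewrite card_Zp. Qed.

(** * The primary factor at one prime *)

Section PrimaryFactor.

Variables (p h : nat) (c : nat -> nat).
Hypothesis p_gt0 : 0 < p.

Lemma order_ppart_group b : b \in ppart_group p h c -> #[b]%g %| p ^ h.
Proof.
move=> /setXnP Gb; apply/order_dvdn_dffun => i; apply/order_dvdn_dffun => j.
have /setXnP/(_ j) := Gb i; move/order_Zp_dvdn; rewrite expn_gt0 p_gt0.
by move=> /(_ isT)/dvdn_trans; apply; apply: dvdn_exp2l.
Qed.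

Lemma card_Ldiv_ppart_group l :
  #|'Ldiv_l(ppart_group p h c)%g| = \prod_(i < h) gcdn l (p ^ i.+1) ^ c i.+1.
Proof.
rewrite card_Ldiv_setXn; apply: eq_bigr => i _.
rewrite card_Ldiv_setXn.
under eq_bigr do rewrite card_Ldiv_Zp ?expn_gt0 ?p_gt0 //.
by rewrite prod_nat_const card_ord.
Qed.

End PrimaryFactor.

Section LevelCounts.

Variables (w p h : nat) (m : nat -> nat).
Hypothesis p_pr : prime p.

Let G := ppart_group p h (fun i => w * m i).

Lemma card_Ldiv_level l :
  #|'Ldiv_(p ^ l)(G)%g| = p ^ (w * \sum_(1 <= i < h.+1) minn l i * m i).
Proof.
rewrite card_Ldiv_ppart_group ?prime_gt0 // big_add1 big_mkord big_distrr /=.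
rewrite expn_sum; apply: eq_bigr => i _.
have -> : gcdn (p ^ l) (p ^ i.+1) = p ^ minn l i.+1.
  have [le_li|/ltnW le_il] := leqP l i.+1.
    by apply/gcdn_idPl/dvdn_exp2l.
  by apply/gcdn_idPr/dvdn_exp2l.
by rewrite -expnM mulnCA.
Qed.

(** The hypotheses say that [l'] is [l] or [l.-1], the two torsion levels whose difference gives the
    [l]-th term. In both cases [minn l' i] is [i] for [i < l] and [l'] for [i >= l]. *)
Lemma sum_minn_split l l' : 0 < l <= h -> l' <= l <= l'.+1 ->
  \sum_(1 <= i < h.+1) minn l' i * m i
  = \sum_(1 <= i < l) i * m i + l' * tail_count h m l.
Proof.
case/andP=> l_gt0 le_lh /andP[le_l'l le_ll'].
rewrite (big_cat_nat l_gt0) ?leqW //=; congr (_ + _).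
  apply: eq_big_nat => i /andP[_ lt_il]; rewrite (minn_idPr _) //.
  by rewrite -ltnS (leq_trans lt_il).
rewrite /tail_count big_distrr /=; apply: eq_big_nat => i /andP[le_li _].
by rewrite (minn_idPl _) // (leq_trans le_l'l).
Qed.

Lemma card_Ldiv_level_pred l : 0 < l <= h ->
  #|'Ldiv_(p ^ l.-1)(G)%g| = p ^ level_exp w h m l.
Proof.
move=> l_bnd; rewrite card_Ldiv_level (sum_minn_split l_bnd) //.
by rewrite leq_pred leqSpred.
Qed.

Lemma card_Ldiv_level_succ l : 0 < l <= h ->
  #|'Ldiv_(p ^ l)(G)%g| = p ^ (w * tail_count h m l) * p ^ level_exp w h m l.
Proof.
move=> l_bnd; rewrite card_Ldiv_level (sum_minn_split l_bnd) ?leqnn ?leqnSn //.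
rewrite -expnD /level_exp -mulnDr addnCA -mulSn prednK //.
by case/andP: l_bnd.
Qed.

Lemma mu_ppart_group : mu G = factor_frac w p h m.
Proof.
rewrite (mu_pgroup_Ldiv p_pr (@order_ppart_group _ _ _ (prime_gt0 p_pr))).
congr (_ + _)%R; apply: eq_big_nat => l; rewrite ltnS => l_bnd.
rewrite card_Ldiv_level_succ // card_Ldiv_level_pred // natrM !natrX.
by rewrite [in RHS]mulrBl mul1r.
Qed.

Lemma factor_frac_exp : factor_frac w p h m = factor_exp w p h m.
Proof.
congr (_ + _)%R; apply: eq_big_nat => l _; rewrite -mulrA; congr (_ * _)%R.
by rewrite expfzDr ?pnatr_eq0 -?lt0n ?prime_gt0 // -exprnN.
Qed.

(** For [h > 0] every summand is nonnegative, and the last one, [l = h], is positive because its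
    tail count is [m h]. *)
Lemma factor_frac_eq1 : 0 < w -> (0 < h -> 0 < m h) ->
  factor_frac w p h m = 1%R <-> h = 0.
Proof.
move=> w_gt0 mh_gt0; split=> [|h0]; last first.
  by rewrite /factor_frac h0 big_geq ?addr0.
have p_gt0 : (0 < p%:R :> rat)%R by rewrite ltr0n prime_gt0.
case: (posnP h) => // h_gt0 /eqP.
rewrite -subr_eq0 /factor_frac addrC addKr big_nat_recr //=; case/negP.
apply/negP/lt0r_neq0/ltr_wpDl.
  apply: sumr_ge0 => l _; rewrite !mulr_ge0 ?invr_ge0 ?exprn_ge0 ?ltW //.
  by rewrite subr_ge0 -natrX ler1n expn_gt0 prime_gt0.
rewrite !mulr_gt0 ?invr_gt0 ?exprn_gt0 // subr_gt0 -natrX ltr1n.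
rewrite -{1}(expn0 p) ltn_exp2l ?prime_gt1 // muln_gt0 w_gt0 /=.
by rewrite /tail_count big_nat1 mh_gt0.
Qed.

End LevelCounts.

(** * Prime exponents of the family and of its lcm *)

Section Family.

Variables (k : nat) (n : 'I_k -> nat).
Hypothesis n_gt0 : forall j, 0 < n j.

Let L := lcm_fam n.

Lemma lcm_fam_gt0 : 0 < L.
Proof. by apply: (big_ind (leq 1)) => // x y; rewrite lcmn_gt0 => -> ->. Qed.

Lemma dvdn_lcm_fam j : n j %| L.
Proof. by rewrite /L /lcm_fam (biglcmn_sup j). Qed.

Lemma logn_lcm_fam p : logn p L = max_logn n p.
Proof.
apply/eqP; rewrite eqn_leq; apply/andP; split; last first.
  apply/bigmax_leqP => j _; exact: dvdn_leq_log lcm_fam_gt0 (dvdn_lcm_fam j).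
(* Positivity is carried through the induction because [logn_lcm] requires it of both arguments. *)
suff /andP[] : (0 < L) && (logn p L <= max_logn n p) by [].
apply: (big_ind (fun x => (0 < x) && (logn p x <= max_logn n p))).
- by rewrite logn1.
- move=> x y /andP[x_gt0 x_le] /andP[y_gt0 y_le].
  by rewrite lcmn_gt0 x_gt0 y_gt0 logn_lcm // geq_max x_le.
by move=> j _; rewrite n_gt0 leq_bigmax.
Qed.

Lemma mem_primes_lcm_fam p : (p \in primes L) = (0 < max_logn n p).
Proof. by rewrite -logn_gt0 logn_lcm_fam. Qed.

Lemma count_max_logn_gt0 p :
  0 < max_logn n p -> 0 < count_logn n p (max_logn n p).
Proof.
move=> h_gt0; have k_gt0 : 0 < #|'I_k|.
  rewrite card_ord lt0n; apply: contraTneq h_gt0 => k0.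
  rewrite /max_logn big_pred0 // => j.
  by have := ltn_ord j; rewrite {2}k0.
have [j hE] := eq_bigmax (fun j => logn p (n j)) k_gt0.
by apply/card_gt0P; exists j; rewrite inE /= -hE.
Qed.

(** The indices [j] are grouped by their exponent at [p]. The group of exponent 0 is absent on the
    left, which is why [F 0 = 1] is assumed. *)
Lemma prod_count_logn p (F : nat -> nat) : F 0 = 1 ->
  \prod_(i < max_logn n p) F i.+1 ^ count_logn n p i.+1
  = \prod_(j < k) F (logn p (n j)).
Proof.
move=> F0; pose lev j : 'I_(max_logn n p).+1 := inord (logn p (n j)).
have levE j : lev j = logn p (n j) :> nat.
  by rewrite inordK // ltnS (leq_bigmax j).
rewrite (partition_big lev predT) //= big_ord_recl /=.
rewrite [X in _ = X * _]big1 ?mul1n; last first.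
  by move=> j /eqP lev0; rewrite -levE lev0.
apply: eq_bigr => i _; rewrite -prod_nat_const; apply: eq_big => j.
  by rewrite inE -levE.
by rewrite inE => /eqP ->.
Qed.

(** Regrouping by [j] turns the product over primes into the factorization of each [gcdn l (n j)].
    Tying [c] to [w] by an equation allows [c] to be [count_logn n] itself, with [w = 1]. *)
Lemma card_Ldiv_primary_prod w c l :
    (forall p i, c p i = w * count_logn n p i) ->
  #|'Ldiv_l(primary_prod (primes L) (max_logn n) c)%g|
  = (\prod_(j < k) gcdn l (n j)) ^ w.
Proof.
move=> cE; rewrite card_Ldiv_setXn.
pose G p := ppart_group p (max_logn n p) (c p).
rewrite (big_seq_sub _ (fun p => #|'Ldiv_l(G p)%g|)) ?primes_uniq //.
rewrite big_seq; under eq_bigr => p.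
  rewrite mem_primes => /and3P[p_pr _ _].
  rewrite card_Ldiv_ppart_group ?prime_gt0 //.
  under eq_bigr do rewrite cE expnM.
  rewrite (prod_count_logn p (F := fun v => gcdn l (p ^ v) ^ w));
    last by rewrite gcdn1 exp1n.
  under eq_bigr do rewrite -p_part.
over.
rewrite -big_seq exchange_big /=.
rewrite (big_morph (expn^~ w) (fun x y => expnMn x y w) (exp1n w)).
apply: eq_bigr => j _; rewrite -(prod_gcdn_partn l lcm_fam_gt0 (dvdn_lcm_fam j)).
by rewrite (big_morph (expn^~ w) (fun x y => expnMn x y w) (exp1n w)).
Qed.

Lemma order_primary_prod c b :
  b \in primary_prod (primes L) (max_logn n) c -> #[b]%g %| L.
Proof.
move=> /setXnP Gb; apply/order_dvdn_dffun => p.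
have := ssvalP p; rewrite mem_primes => /and3P[p_pr _ _].
apply: dvdn_trans (order_ppart_group (prime_gt0 p_pr) (Gb p)) _.
by rewrite -logn_lcm_fam pfactor_dvdnn.
Qed.

Lemma mu_primary_prod c :
  mu (primary_prod (primes L) (max_logn n) c)
  = (\prod_(p <- primes L) mu (ppart_group p (max_logn n p) (c p)))%R.
Proof.
rewrite -(big_seq_sub _ _ (primes_uniq L)).
have prP (p : seq_sub (primes L)) : prime (ssval p).
  by have := ssvalP p; rewrite mem_primes => /and3P[].
apply: (mu_setXn_coprime (e := fun p => ssval p ^ max_logn n (ssval p))).
  by move=> p y; apply: order_ppart_group; rewrite prime_gt0.
move=> p q ne_pq; rewrite coprimeXl // coprimeXr //.
by rewrite prime_coprime // dvdn_prime2.
Qed.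

(** * The isomorphism with the product of primary parts *)

(* The [c]-th component at [(p, i)] reduces modulo [p ^ i.+1] the coordinate of
   [x] at the [c]-th index [j] with [logn p (n j) = i.+1]. *)
Definition residues (x : {dffun forall j, 'Z_(n j)}) :
    {dffun forall p : seq_sub (primes L),
     {dffun forall i : 'I_(max_logn n (ssval p)),
     {dffun forall c : 'I_(count_logn n (ssval p) i.+1), 'Z_(ssval p ^ i.+1)}}} :=
  [ffun p : seq_sub (primes L) => [ffun i : 'I_(max_logn n (ssval p)) =>
    [ffun c : 'I_(count_logn n (ssval p) i.+1) =>
      inZp (x (enum_val c)) : 'Z_(ssval p ^ i.+1)]]].

Lemma residues_morphM : {morph residues : x y / (x * y)%g}.
Proof.
move=> x y; apply/ffunP => p; rewrite !ffunE; apply/ffunP => i; rewrite !ffunE.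
apply/ffunP => c; rewrite !ffunE; apply: val_inj => /=.
have /eqP lognE : logn (ssval p) (n (enum_val c)) == i.+1 by have := enum_valP c.
have p_pr : prime (ssval p) by have := ssvalP p; rewrite mem_primes => /and3P[].
have dvd_q : ssval p ^ i.+1 %| n (enum_val c) by rewrite pfactor_dvdn // lognE.
(* Arithmetic in ['Z_d] is modulo [d] only when [d > 1], so both moduli must be bounded below before
   [Zp_cast] applies. *)
have q_gt1 : 1 < ssval p ^ i.+1 by rewrite -(expn0 (ssval p)) ltn_exp2l ?prime_gt1.
have n_gt1 := leq_trans q_gt1 (dvdn_leq (n_gt0 _) dvd_q).
move: (nat_of_ord (x (enum_val c))) (nat_of_ord (y (enum_val c))) => a b.
by rewrite !Zp_cast // modn_dvdm // modnDm.
Qed.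

Lemma residues_in x :
  residues x \in primary_prod (primes L) (max_logn n) (count_logn n).
Proof.
apply/setXnP => p; apply/setXnP => i; apply/setXnP => c.
have p_pr : prime (ssval p) by have := ssvalP p; rewrite mem_primes => /and3P[].
by rewrite /= /Zp -(expn0 (ssval p)) ltn_exp2l ?prime_gt1 ?inE.
Qed.

(** If all residues vanish, then each prime-power part of [n j] divides [x j], hence so does [n j];
    as [x j < n j], this forces [x j = 0]. When [n j = 1], membership in the trivial group [Zp 1]
    already gives the claim. *)
Lemma residues_eq1 x : x \in cyclic_prod n -> residues x = 1%g -> x = 1%g.
Proof.
move=> /setXnP Gx rx1; apply/ffunP => j; rewrite oneg_ffun.
have := Gx j; rewrite /= /Zp; case: ifP => [n_gt1 _|_ /set1gP //].
apply: val_inj => /=; suff dvd_nx : n j %| x j.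
  apply/eqP; rewrite -leqn0 leqNgt; apply/negP => x_gt0.
  have := dvdn_leq x_gt0 dvd_nx; rewrite leqNgt.
  by rewrite -{2}(Zp_cast n_gt1) ltn_ord.
apply/dvdn_partP => // p; rewrite -[p \in _]/(p \in primes (n j)) => p_nj.
have p_pr : prime p by move: p_nj; rewrite mem_primes => /and3P[].
have v_gt0 : 0 < logn p (n j) by rewrite logn_gt0.
have pL : p \in primes L.
  by rewrite -logn_gt0 (leq_trans v_gt0) // logn_lcm_fam (leq_bigmax j).
have lt_vh : (logn p (n j)).-1 < max_logn n p.
  by rewrite prednK // (leq_bigmax j).
have j_in : j \in [pred j' | logn p (n j') == (logn p (n j)).-1.+1].
  by rewrite inE prednK.
(* This is the position of [j] among the indices with the same exponent at [p], so the component at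
   [c] is the reduction of [x j]. *)
pose c : 'I_(count_logn n p (logn p (n j)).-1.+1) := enum_rank_in j_in j.
have: residues x (SeqSub pL) (Ordinal lt_vh) c = 0 :> nat.
  by rewrite rx1 !oneg_ffun.
rewrite !ffunE /= enum_rankK_in // prednK // -p_part.
move: (nat_of_ord (x j)) => a; rewrite Zp_cast; first by move/eqP.
by rewrite p_part -(expn0 p) ltn_exp2l ?prime_gt1.
Qed.

Lemma card_Ldiv_cyclic_prod l :
  #|'Ldiv_l(cyclic_prod n)%g| = \prod_(j < k) gcdn l (n j).
Proof. by rewrite card_Ldiv_setXn; apply: eq_bigr => j _; rewrite card_Ldiv_Zp. Qed.

Lemma isog_cyclic_primary_prod :
  (cyclic_prod n \isog primary_prod (primes L) (max_logn n) (count_logn n))%g.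
Proof.
(* The 0-torsion is the whole group and [gcdn 0 d = d], so the torsion counts at [l = 0] show that
   both groups have the same order, and injectivity of [f] suffices. *)
have Ldiv0 (gT : finGroupType) (G : {group gT}) : 'Ldiv_0(G)%g = G.
  by apply/finset.setIidPl/fintype.subsetP => x _; rewrite inE expg0.
pose f := Morphism (D := cyclic_prod n) (in2W residues_morphM).
have injf : ('injm f)%g.
  apply/fintype.subsetP => x Kx; apply/set1gP.
  exact: residues_eq1 (dom_ker Kx) (mker Kx).
apply/isogP; exists f => //; apply/eqP; rewrite eqEcard; apply/andP; split.
  apply/fintype.subsetP => _ /morphimP[x _ _ ->]; exact: residues_in.
rewrite card_injm // -(Ldiv0 _ (cyclic_prod n)) card_Ldiv_cyclic_prod.
rewrite -(Ldiv0 _ (primary_prod _ _ _)) (card_Ldiv_primary_prod (w := 1)) //.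
by move=> p i; rewrite mul1n.
Qed.

End Family.

Local Open Scope ring_scope.

Theorem theorem1p7 (k : nat) (n : 'I_k -> nat) (w : nat)
    (n_gt0 : forall j, (0 < n j)%N) (w_gt0 : (0 < w)%N) :
  let L := lcm_fam n in
  let h := max_logn n in
  let m := count_logn n in
  let mu_factor p := mu (ppart_group p (h p) (fun i => (w * m p i)%N)) in
  let frac_factor p := factor_frac w p (h p) (m p) in
  let exp_factor p := factor_exp w p (h p) (m p) in
  let primeset := [set p : nat | prime p]%classic in
  [/\ (cyclic_prod n \isog primary_prod (primes L) h m)%g,
      [/\ (L%:R : rat)^-1 *
            \sum_(1 <= l < L.+1) ((\prod_(j < k) gcdn l (n j)) ^ w)%N%:R
          = \big[*%R/1]_(p \in primeset) mu_factor p,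
          \big[*%R/1]_(p \in primeset) mu_factor p
          = \big[*%R/1]_(p \in primeset) frac_factor p
        & \big[*%R/1]_(p \in primeset) frac_factor p
          = \big[*%R/1]_(p \in primeset) exp_factor p],
      finite_set [set p : nat | prime p /\ h p <> 0%N]%classic
    & forall p : nat, prime p ->
      [/\ mu_factor p = 1 <-> h p = 0%N,
          frac_factor p = 1 <-> h p = 0%N
        & exp_factor p = 1 <-> h p = 0%N]].
Proof.
move=> L h m mu_factor frac_factor exp_factor primeset.
have L_gt0 : (0 < L)%N by apply: lcm_fam_gt0.
have mu_frac p : prime p -> mu_factor p = frac_factor p.
  by move=> p_pr; apply: mu_ppart_group.
have frac_exp p : prime p -> frac_factor p = exp_factor p.
  by move=> p_pr; apply: factor_frac_exp.
have frac1 p : prime p -> frac_factor p = 1 <-> h p = 0%N.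
  move=> p_pr; apply: factor_frac_eq1 => //; exact: count_max_logn_gt0.
split.
- exact: isog_cyclic_primary_prod.
- split.
  + pose c p i := (w * m p i)%N.
    have -> : \big[*%R/1]_(p \in primeset) mu_factor p
            = \prod_(p <- primes L) mu_factor p.
      (* A prime outside [primes L] has [h p = 0], so its factor is 1 and the product over all
         primes reduces to this finite list. *)
      rewrite [RHS](@fsbig_seq _ _ _ _ (primes L)) ?primes_uniq //; apply/esym.
      apply: fsbig_widen.
        by move=> p /=; rewrite mem_primes => /and3P[].
      move=> p [/= p_pr pL]; rewrite mu_frac //; apply/frac1 => //.
      by apply/eqP; rewrite -leqn0 leqNgt -mem_primes_lcm_fam //; apply/negP.
    rewrite -(mu_primary_prod n c).
    (* Multiplying by [L] leaves the double count of pairs, applied to a group whose element orders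
       all divide [L]. *)
    apply: (canLR (mulKf _)); first by rewrite pnatr_eq0 -lt0n.
    rewrite mul_mu_sum_Ldiv //; last by move=> b; apply: order_primary_prod.
    by apply: eq_bigr => l _; rewrite (card_Ldiv_primary_prod n_gt0 (w := w)).
  + by apply: eq_fsbigr => p; rewrite inE => /mu_frac.
  + by apply: eq_fsbigr => p; rewrite inE => /frac_exp.
- apply: (sub_finite_set _ (finite_seq (primes L))) => p /= [p_pr /eqP].
  by rewrite mem_primes_lcm_fam // lt0n.
by move=> p p_pr; rewrite mu_frac // -frac_exp //; split; apply: frac1.
Qed.
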